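(* For every integer $d\ge 2$, there exist infinitely many positive integers $a$ such that $s_Z(a)=s_Z(a+F_d)=s_Z(a+2F_d)$. Furthermore, for every integer $d\ge 2$, there does not exist a positive integer $a$ such that $s_Z(a)=s_Z(a+F_d)=s_Z(a+2F_d)=s_Z(a+3F_d)$.
   Context: Let $F_i$ be the Fibonacci numbers: $F_0=0$, $F_1=1$, $F_i=F_{i-1}+F_{i-2}$ for $i\ge 2$. By Zeckendorf's theorem, every positive integer $n$ has a unique sequence $(\zeta_i(n))_{i=2}^\infty$ with $\zeta_i(n)\in\{0,1\}$ and $\zeta_i(n)+\zeta_{i+1}(n)\le 1$ for all $i\ge 2$, such that $n=\sum_{i=2}^\infty \zeta_i(n)F_i$ (the Zeckendorf decomposition of $n$). Put $s_Z(n)=\sum_{i=2}^\infty\zeta_i(n)$, the number of summands in the Zeckendorf decomposition of $n$. *)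

(* Defs.v *)
From mathcomp Require Import all_boot.
From mathcomp Require Import zify.

Set Implicit Arguments.
Unset Strict Implicit.
Unset Printing Implicit Defensive.

Fixpoint fib (n : nat) : nat :=
  match n with
  | 0 => 0
  | 1 => 1
  | (m.+1 as p).+1 => fib p + fib m
  end.

Arguments fib : simpl never.

(* [z] encodes a finitely supported 0/1 sequence: its i-th digit is
   [nth false z i], hence 0 beyond [size z]. Only the digits of index at least 2
   matter; the entries of [z] at 0 and 1 are unconstrained and never used. *)
Definition is_zeckendorf (n : nat) (z : bitseq) : bool :=
  all (fun i => nth false z i + nth false z i.+1 <= 1) (iota 2 (size z))
  && (n == \sum_(2 <= i < size z) nth false z i * fib i).

Lemma fibSS n : fib n.+2 = fib n.+1 + fib n.
Proof. by []. Qed.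

Lemma fib_gt0 n : 0 < fib n.+1.
Proof. by elim: n => // n IHn; rewrite fibSS addn_gt0 IHn. Qed.

Lemma ltn_fib n : n < fib n.+2.
Proof.
elim: n => // n IHn; rewrite fibSS.
by have := fib_gt0 n; lia.
Qed.

Lemma exists_zeckendorf_digits k n : n < fib k.+2 ->
  exists f : nat -> bool,
    [/\ forall i, 2 <= i -> f i + f i.+1 <= 1,
        forall i, k.+2 <= i -> f i = false
      & n = \sum_(2 <= i < k.+2) f i * fib i].
Proof.
have [m] := ubnP k; elim: m k n => // m IHm k n ltkm.
case: k ltkm => [_|k ltkm].
  case: n => // _; exists (fun=> false); split=> //.
  by rewrite big_geq.
have [lt_n _|le_n] := ltnP n (fib k.+2).
  have [f [f1 f2 f3]] := IHm k n ltkm lt_n.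
  exists f; split=> [//|i lei|].
    by apply: f2; lia.
  by rewrite big_nat_recr //= f2 // mul0n addn0.
case: k le_n ltkm => [|k] le_n ltkm; rewrite fibSS => lt_n.
  have -> : n = 1 by move: le_n lt_n; rewrite /fib; lia.
  exists (pred1 2); split=> [i|i|] /=.
  - by case: eqP; case: eqP => //; lia.
  - by case: eqP => //; lia.
  - by rewrite big_nat1.
have lt_r : n - fib k.+3 < fib k.+2 by rewrite ltn_subLR.
have [|f [f1 f2 f3]] := IHm k _ _ lt_r; first by lia.
exists (fun i => (i == k.+3) || f i); split=> [i lei|i lei|].
- case: eqP => [->|_] /=.
    by rewrite f2 ?orbF; [rewrite gtn_eqF|lia].
  case: eqP => [[->]|_] /=; last exact: f1.
  by rewrite f2.
- by rewrite f2; [rewrite orbF; apply/negbTE; lia|lia].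
- rewrite big_nat_recr //= eqxx mul1n big_nat_recr //= f2 //.
  rewrite orbF (_ : k.+2 == k.+3 = false) ?mul0n ?addn0; last by apply/negbTE; lia.
  rewrite (eq_big_nat _ _ (F2 := fun i => f i * fib i)) -?f3; first by rewrite subnK.
  move=> i /andP[_ lti]; rewrite (_ : i == k.+3 = false) //.
  by apply/negbTE; lia.
Qed.

Lemma exists_zeckendorf n : exists z, is_zeckendorf n z.
Proof.
have [f [f1 f2 f3]] := exists_zeckendorf_digits (ltn_fib n).
have nthf i : nth false (mkseq f n.+2) i = f i.
  have [lti|lei] := ltnP i n.+2; first by rewrite nth_mkseq.
  by rewrite nth_default ?size_mkseq // f2.
exists (mkseq f n.+2); apply/andP; split.
  by apply/allP=> i; rewrite mem_iota => /andP[lei _]; rewrite !nthf f1.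
rewrite size_mkseq {1}f3; apply/eqP/eq_bigr => i _.
by rewrite nthf.
Qed.

Definition zeckendorf (n : nat) : bitseq := xchoose (exists_zeckendorf n).

Definition zeta (n i : nat) : bool := nth false (zeckendorf n) i.

Definition s_Z (n : nat) : nat := \sum_(2 <= i < size (zeckendorf n)) zeta n i.

Lemma sum_zeckendorf_lt (f : nat -> bool) k :
  (forall i, 2 <= i -> f i + f i.+1 <= 1) ->
  \sum_(2 <= i < k.+1) f i * fib i < fib k.+1.
Proof.
move=> f1; have [m] := ubnP k; elim: m k => // m IHm k ltkm.
case: k ltkm => [|[|k]] ltkm; [by rewrite big_geq|by rewrite big_geq|].
rewrite big_nat_recr //=.
have := IHm k.+1 ltkm.
rewrite (fibSS k.+1).
case fk: (f k.+2); last by rewrite mul0n addn0; lia.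
case: k ltkm fk => [|k] ltkm fk; first by rewrite big_geq.
have fk' : f k.+2 = false.
  by have := f1 k.+2 isT; rewrite fk; case: (f k.+2).
rewrite big_nat_recr //= fk' mul0n addn0 mul1n.
have := IHm k.+1 (ltnW ltkm).
by rewrite addnC ltn_add2l.
Qed.

Lemma zeckendorf_digits_unique (f g : nat -> bool) k :
  (forall i, 2 <= i -> f i + f i.+1 <= 1) ->
  (forall i, 2 <= i -> g i + g i.+1 <= 1) ->
  \sum_(2 <= i < k) f i * fib i = \sum_(2 <= i < k) g i * fib i ->
  forall i, 2 <= i < k -> f i = g i.
Proof.
move=> f1 g1; elim: k => [|k IHk] // eqs i; first by rewrite andbC.
have [le2k|lt2k] := leqP 2 k; last by lia.
case: k le2k IHk eqs => // k le2k IHk; rewrite !(big_nat_recr k.+1) //=.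
have := sum_zeckendorf_lt k f1; have := sum_zeckendorf_lt k g1.
case fk: (f k.+1); case gk: (g k.+1); rewrite ?mul1n ?mul0n;
  move=> ltg ltf eqs /andP[le2i]; try lia;
  rewrite ltnS leq_eqVlt => /predU1P[->|lti]; rewrite ?fk ?gk //;
  apply: IHk; rewrite ?le2i //; lia.
Qed.

(* Zeckendorf's theorem for [zeta]: it satisfies the defining conditions of the
   decomposition, and is the only digit sequence indexed from 2 that does. *)
Lemma zetaP n :
  [/\ forall i, 2 <= i -> zeta n i + zeta n i.+1 <= 1,
      forall i, size (zeckendorf n) <= i -> zeta n i = false
    & n = \sum_(2 <= i < size (zeckendorf n)) zeta n i * fib i].
Proof.
have /andP[/allP z1 /eqP z2] := xchooseP (exists_zeckendorf n).
split=> // [i lei|i lei]; last exact: nth_default.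
have [lti|gei] := ltnP i (size (zeckendorf n)); last first.
  by rewrite /zeta !nth_default // ltnW.
by apply: z1; rewrite mem_iota lei; rewrite /zeckendorf in lti *; lia.
Qed.

Lemma sum_nat_widen0 (F : nat -> nat) k l : k <= l ->
  (forall i, k <= i -> F i = 0) ->
  \sum_(2 <= i < k) F i = \sum_(2 <= i < l) F i.
Proof.
move=> lekl F0; elim: l lekl => [|l IHl] lekl; first by rewrite !big_geq //; lia.
case: (ltngtP k l.+1) lekl => // [ltkl|->] _ //.
have [le2l|lt2l] := leqP 2 l.
  by rewrite big_nat_recr //= F0 ?addn0 ?IHl.
by rewrite !big_geq //; lia.
Qed.

Lemma zeta_unique n (f : nat -> bool) k :
  (forall i, 2 <= i -> f i + f i.+1 <= 1) ->
  (forall i, k <= i -> f i = false) ->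
  n = \sum_(2 <= i < k) f i * fib i ->
  forall i, 2 <= i -> f i = zeta n i.
Proof.
move=> f1 f2 f3 i le2i; have [z1 z2 z3] := zetaP n.
pose l := maxn i.+1 (maxn k (size (zeckendorf n))).
apply: (@zeckendorf_digits_unique f (zeta n) l) => //; last by rewrite /l; lia.
rewrite -(@sum_nat_widen0 _ k) -?f3; [|by rewrite /l; lia|by move=> j /f2->].
by rewrite -(@sum_nat_widen0 _ (size (zeckendorf n))) //;
  [rewrite /l; lia|move=> j /z2->].
Qed.

Lemma s_Z_unique n (f : nat -> bool) k :
  (forall i, 2 <= i -> f i + f i.+1 <= 1) ->
  (forall i, k <= i -> f i = false) ->
  n = \sum_(2 <= i < k) f i * fib i ->
  s_Z n = \sum_(2 <= i < k) f i.
Proof.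
move=> f1 f2 f3; have fz := zeta_unique f1 f2 f3; have [_ z2 _] := zetaP n.
pose l := maxn k (size (zeckendorf n)).
rewrite /s_Z (@sum_nat_widen0 _ _ l);
  [|by rewrite /l; lia|by move=> j /z2->].
rewrite (@sum_nat_widen0 _ k l); [|by rewrite /l; lia|by move=> j /f2->].
by apply: eq_big_nat => j /andP[/fz-> _].
Qed.

(* Main.v *)
Require Import Defs.
From mathcomp Require Import all_boot.
From mathcomp Require Import zify.
From mathcomp Require Import classical_sets cardinality.

(** Cut [a] at the index [d]. Adding [fib d] only moves a bounded pattern of
    digits around [d], up to a carry going up, which can only decrease the
    number of summands, and, when digit [d] is already present, an addition of
    [fib (d - 2)] to the low part, which increases it by at most one.
    Following the pattern, every chain of two steps that preserve the number of
    summands makes the third step either create a summand or trigger a strictly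
    decreasing carry. For large [N],
    [fib N + fib d.-1], [fib N + fib d.+1], [fib N + fib d.+2] are in arithmetic
    progression of difference [fib d], with two summands each (for [d = 2] the
    first one is [fib N + 1]). *)

Local Open Scope classical_set_scope.

Set Implicit Arguments.
Unset Strict Implicit.

(** * Fibonacci monotonicity and adding a top summand *)

Lemma leq_fib m n : m <= n -> fib m <= fib n.
Proof.
move=> /subnKC <-; elim: (n - m) => [|k IHk]; first by rewrite addn0.
rewrite addnS; apply: (leq_trans IHk); case: (m + k) => // p.
by rewrite fibSS leq_addr.
Qed.

Lemma fib_ltn m n : 1 < m < n -> fib m < fib n.
Proof.
case: m => [|[|m]] // /andP[_ ltmn]; apply: leq_trans (leq_fib ltmn).
by rewrite (fibSS m.+1) -addn1 leq_add2l fib_gt0.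
Qed.

Lemma s_Z0 : s_Z 0 = 0.
Proof. by rewrite (@s_Z_unique 0 (fun=> false) 2) // big_geq. Qed.

(** The indices of [B] are at most [i], so [i.+2] is adjacent to none of them. *)
Lemma s_Z_fibD i B : B < fib i.+1 -> s_Z (fib i.+2 + B) = (s_Z B).+1.
Proof.
move=> ltB; have [|f [f1 f2 f3]] := @exists_zeckendorf_digits i.-1 B.
  by apply: (leq_trans ltB); apply: leq_fib; lia.
have widen (F : nat -> nat) : (forall j, i.-1.+2 <= j -> F j = 0) ->
    \sum_(2 <= j < i.-1.+2) F j = \sum_(2 <= j < i.+2) F j.
  by apply: sum_nat_widen0; lia.
have sB : s_Z B = \sum_(2 <= j < i.+2) f j.
  by rewrite (s_Z_unique f1 f2 f3) widen // => j /f2 ->.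
rewrite widen in f3; last by move=> j /f2 ->.
rewrite (@s_Z_unique _ (fun j => (j == i.+2) || f j) i.+3).
- rewrite big_nat_recr //= eqxx addn1 sB; congr _.+1.
  by apply: eq_big_nat => j /andP[_ ltj]; rewrite ltn_eqF.
- move=> j le2j; have := f1 j le2j.
  have [->|nj] := eqVneq j i.+2; first by rewrite (f2 i.+3); lia.
  by have [ej|_] := eqVneq j.+1 i.+2; rewrite // (f2 j); lia.
- by move=> j lej; rewrite f2 ?orbF; [apply/negbTE; lia|lia].
- rewrite big_nat_recr //= eqxx mul1n addnC {1}f3; congr (_ + _).
  by apply: eq_big_nat => j /andP[_ ltj]; rewrite ltn_eqF.
Qed.

(** * High parts, carries and cutting at an index *)

(* [zeck_above k A]: all Zeckendorf indices of [A] are at least [k]. They are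
   listed lowest first, so that a carry follows the induction. *)
Inductive zeck_above : nat -> nat -> Prop :=
| ZeckAbove0 k : zeck_above k 0
| ZeckAboveD k i A : k <= i -> zeck_above i.+2 A -> zeck_above k (fib i + A).

Lemma zeck_above_le k l A : l <= k -> zeck_above k A -> zeck_above l A.
Proof.
move=> lelk zA; case: zA lelk => [k' _|k' i A' leki zA' lelk].
  exact: ZeckAbove0.
by apply: ZeckAboveD => //; lia.
Qed.

Lemma zeck_above_case k A : zeck_above k A ->
  zeck_above k.+1 A \/ exists2 A', zeck_above k.+2 A' & A = fib k + A'.
Proof.
case=> [k'|k' i A']; first by left; apply: ZeckAbove0.
rewrite leq_eqVlt => /predU1P[->|ltki] zA'; first by right; exists A'.
by left; apply: ZeckAboveD.
Qed.

(** The induction moves the lowest summand [fib i] of [A] into the low part, which stays below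
    [fib i.+1]; hence [k] and [B] are generalized. *)
Lemma s_Z_split k A B : 0 < k -> zeck_above k.+1 A -> B < fib k ->
  s_Z (A + B) = s_Z A + s_Z B.
Proof.
suff H l A' : zeck_above l A' -> forall k B, 0 < k < l -> B < fib k ->
    s_Z (A' + B) = s_Z A' + s_Z B.
  by move=> k0 zA ltB; apply: (H k.+1 A zA k); rewrite ?k0 /=.
elim=> {l A'} [l|l i A' leli zA' IH] {}k {}B /andP[k0 ltkl] ltB.
  by rewrite s_Z0.
case: i leli zA' IH => [|[|i]] leli zA' IH; try lia.
have ltB' : B < fib i.+1.
  by apply: (leq_trans ltB); apply: leq_fib; lia.
have E C : C < fib i.+1 -> s_Z (fib i.+2 + A' + C) = s_Z A' + (s_Z C).+1.
  move=> ltC; rewrite -(@s_Z_fibD i) // -(IH i.+3) //; first by congr s_Z; lia.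
  - by rewrite !ltnS leqnn.
  - by rewrite (fibSS i.+1) ltn_add2l.
have := E 0 (fib_gt0 i); rewrite addn0 s_Z0 E // => ->.
by rewrite addn1 addSn addnS.
Qed.

Lemma s_Z_aboveD i A : 2 <= i -> zeck_above i.+2 A ->
  s_Z (fib i + A) = (s_Z A).+1.
Proof.
case: i => [|[|i]] // _ zA; rewrite addnC (@s_Z_split i.+3) //.
  by rewrite -{1}[fib i.+2]addn0 s_Z_fibD ?fib_gt0 // s_Z0 addn1.
by rewrite (fibSS i.+1); have := fib_gt0 i; lia.
Qed.

(** If [i.+1] is an index of [A], it merges with [i] into [i.+2] and the carry goes on from there;
    each merge trades two summands for one. *)
Lemma zeck_above_carry i A : 2 <= i -> zeck_above i.+1 A ->
  zeck_above i (fib i + A) /\ s_Z (fib i + A) <= (s_Z A).+1.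
Proof.
move=> le2i zA; have [l el] : exists l, l = i.+1 by exists i.+1.
rewrite -el in zA; elim: zA i le2i el => {l A} [l|l j A lelj zA IH] i le2i el.
  split; first by apply: ZeckAboveD => //; apply: ZeckAbove0.
  by rewrite s_Z_aboveD //; apply: ZeckAbove0.
have le2j : 2 <= j by lia.
have [ltij|] := ltnP i.+1 j.
  have zA' : zeck_above i.+2 (fib j + A) by apply: ZeckAboveD.
  by split; [apply: ZeckAboveD|rewrite s_Z_aboveD].
move=> leji; have {lelj leji el} ej : j = i.+1 by lia.
subst j; have [|z1 z2] := IH i.+2 _ erefl; first by lia.
rewrite addnA [fib i + _]addnC -fibSS (@s_Z_aboveD i.+1) //; split.
  by apply: zeck_above_le z1; lia.
exact: leqW.
Qed.

(** If digit [d] is 0, the first form holds; if it is 1, digit [d.-1] is 0 and the second holds. *)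
Lemma zeck_cut d a : 0 < d -> exists A B, a = A + B /\
  ((zeck_above d.+1 A /\ B < fib d) \/ (zeck_above d A /\ B < fib d.-1)).
Proof.
(* Greedy descent: [A] holds the summands taken, [r] the rest. [N] drops by one or, after a summand
   is taken, by two, so it stops at [d] or [d.-1]. *)
move=> d0; suff H N A r : d.-1 <= N -> zeck_above N.+1 A -> r < fib N ->
    exists A' B, A + r = A' + B /\
    ((zeck_above d.+1 A' /\ B < fib d) \/ (zeck_above d A' /\ B < fib d.-1)).
  apply: (H (a + d).+2 0 a); [lia|exact: ZeckAbove0|].
  by apply: (leq_trans (ltn_fib a)); apply: leq_fib; lia.
elim/ltn_ind: N A r => N IH A r leN zA ltr.
have [ltdN|leNd] := ltnP d N; last first.
  exists A, r; split=> //.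
  have [eN|neN] := eqVneq N d; first by rewrite eN in zA ltr; left.
  have eN : N = d.-1 by lia.
  by right; rewrite eN prednK // in zA ltr.
case: N IH leN zA ltr ltdN => [|[|N]] IH leN zA ltr ltdN; try lia.
have [ltr'|ler] := ltnP r (fib N.+1).
  by apply: (IH N.+1) => //; [lia|apply: zeck_above_le zA].
have [||||A' [B [e ?]]] := IH N _ (fib N.+1 + A) (r - fib N.+1); try lia.
- exact: ZeckAboveD.
- by rewrite fibSS in ltr; lia.
- by exists A', B; split=> //; rewrite -e; lia.
Qed.

(** For [2 <= j], a leading [fib j.-1] of [B] merges with [fib j]; a leading [fib j] is doubled, and
    [2 * fib j = fib j.+1 + fib (j - 2)] leads back to index [j - 2]. *)
Lemma s_Z_fibD_le j B : B < fib j.+1 -> s_Z (fib j + B) <= (s_Z B).+1.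
Proof.
elim/ltn_ind: j B => [[|[|j]]] IH B ltB.
- by rewrite add0n.
- by case: B ltB => // _; rewrite (@s_Z_fibD 0) // s_Z0.
have [ltB1|leB1] := ltnP B (fib j.+1); first by rewrite s_Z_fibD.
have [ltB2|leB2] := ltnP B (fib j.+2).
  case: j IH ltB leB1 ltB2 => [|j] _ _; first by rewrite /fib; lia.
  move=> leB1; rewrite -(subnKC leB1); move: (B - _) => C ltC.
  have ltC' : C < fib j.+1 by move: ltC; rewrite (fibSS j.+1); lia.
  rewrite addnA -fibSS !s_Z_fibD //.
  by apply: (leq_trans ltC'); apply: leq_fib; lia.
move: ltB; rewrite -(subnKC leB2); move: (B - _) => C.
rewrite fibSS ltn_add2l => ltC.
rewrite (@s_Z_fibD j C) //.
have -> : fib j.+2 + (fib j.+2 + C) = fib j.+3 + (fib j + C).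
  by rewrite (fibSS j.+1) (fibSS j); lia.
by rewrite s_Z_fibD ?ltnS; [apply: IH|rewrite (fibSS j) addnC ltn_add2r].
Qed.

(** * Digit patterns around [d] that exclude a fourth term *)

Section DigitPatterns.

Variable e : nat.
Local Notation d := e.+2.

(* A low part of at least [fib d.-1] is [fib d.-1 + C] with [C < fib (d - 2)],
   and [fib d] merges with its leading term. *)
Lemma low_part_case B : B < fib d ->
  B < fib e.+1 \/ exists C, [/\ C < fib e, B = fib e.+1 + C,
    fib d + B = fib d.+1 + C & s_Z B = (s_Z C).+1].
Proof.
move=> ltB; have [ltB1|leB1] := ltnP B (fib e.+1); [by left|right].
exists (B - fib e.+1).
have ltC : B - fib e.+1 < fib e by move: ltB; rewrite fibSS; lia.
split=> //; first by rewrite subnKC.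
  by rewrite (fibSS e.+1); lia.
rewrite -{1}(subnKC leB1) /=; case: e ltC => [|e'] ltC; first by [].
rewrite s_Z_fibD //; apply: (leq_trans ltC); exact: leq_fib.
Qed.

(** Digits [d.-1], [d] and [d.+1] are 0, so [fib d] is a new summand. *)
Lemma s_Z_add_fib_low A B : zeck_above d.+2 A -> B < fib e.+1 ->
  s_Z (A + B + fib d) = (s_Z (A + B)).+1.
Proof.
move=> zA ltB; have -> : A + B + fib d = fib d + A + B by lia.
rewrite (@s_Z_split e.+1 (fib d + A)) //; last exact: ZeckAboveD.
rewrite (@s_Z_split e.+1 A) ?s_Z_aboveD //.
by apply: zeck_above_le zA; lia.
Qed.

Lemma no_three_from_fib_dS A B : zeck_above d.+3 A -> B < fib d ->
  let a := fib d.+1 + A + B in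
  s_Z a = s_Z (a + fib d) -> s_Z (a + fib d) = s_Z (a + 2 * fib d) -> False.
Proof.
move=> zA ltB a.
have z1 : zeck_above d.+1 (fib d.+1 + A) by apply: ZeckAboveD.
have -> : a + fib d = fib d.+2 + A + B by rewrite /a (fibSS d); lia.
have -> : a + 2 * fib d = fib d.+2 + A + B + fib d.
  by rewrite /a (fibSS d); lia.
have zA' := zeck_above_carry (isT : 2 <= d.+2) zA.
rewrite /a (@s_Z_split d _ B) // s_Z_aboveD // (@s_Z_split d _ B) //; last first.
  by apply: zeck_above_le (proj1 zA').
(* If [d.+3] is an index of [A], the first step carries past it and loses a summand. *)
have [zA4|[A' zA5 eA]] := zeck_above_case zA; last first.
  have [|_ leA'] := @zeck_above_carry d.+4 A' isT _.
    by apply: zeck_above_le zA5.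
  have -> : fib d.+2 + A = fib d.+4 + A' by rewrite eA (fibSS d.+2); lia.
  by rewrite eA s_Z_aboveD //; lia.
(* Otherwise the second step creates a summand, or produces [fib d.+1], which merges with
   [fib d.+2]. *)
move=> _; have [ltB1|[C [ltC eB eD sB]]] := low_part_case ltB.
  rewrite s_Z_add_fib_low //; last exact: ZeckAboveD.
  rewrite (@s_Z_split d _ B) //; first by lia.
  by apply: zeck_above_le (proj1 zA').
have -> : fib d.+2 + A + B + fib d = fib d.+3 + A + C.
  by rewrite (fibSS d.+1); lia.
have [z3 le3] := zeck_above_carry (isT : 2 <= d.+3) zA4.
rewrite (@s_Z_split d _ C) //; last first.
- by apply: (leq_trans ltC); apply: leq_fib; lia.
- by apply: zeck_above_le z3; lia.
by rewrite s_Z_aboveD //; lia.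
Qed.

(** Either the first step changes the count, or [a] or [a + fib d] has the pattern of
    [no_three_from_fib_dS]. *)
Lemma no_four_digit_d0 A B : zeck_above d.+1 A -> B < fib d ->
  let a := A + B in
  s_Z a = s_Z (a + fib d) -> s_Z (a + fib d) = s_Z (a + 2 * fib d) ->
  s_Z (a + 2 * fib d) = s_Z (a + 3 * fib d) -> False.
Proof.
move=> zA ltB a; have [zA2|[A' zA3 eA]] := zeck_above_case zA; last first.
  by rewrite /a eA => e1 e2 _; apply: (no_three_from_fib_dS zA3 ltB).
have [ltB1|[C [ltC eB eD sB]]] := low_part_case ltB.
  by rewrite /a s_Z_add_fib_low //; lia.
have ltC' : C < fib d by apply: (leq_trans ltC); apply: leq_fib; lia.
have ea1 : a + fib d = fib d.+1 + A + C by rewrite /a; lia.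
have [zA3|[A' zA4 eA]] := zeck_above_case zA2.
  have -> : a + 3 * fib d = fib d.+1 + A + C + 2 * fib d by lia.
  have -> : a + 2 * fib d = fib d.+1 + A + C + fib d by lia.
  by rewrite ea1 => _; apply: no_three_from_fib_dS.
have [z3 le3] := @zeck_above_carry d.+3 A' isT zA4.
have -> : a + fib d = fib d.+3 + A' + C.
  by rewrite ea1 eA (fibSS d.+1); lia.
rewrite /a (@s_Z_split d _ B) // (@s_Z_split d _ C) //; last first.
  by apply: zeck_above_le z3; lia.
by rewrite sB eA s_Z_aboveD //; lia.
Qed.

Lemma no_four_digit_d1 A B : zeck_above d.+2 A -> B < fib e.+1 ->
  let a := fib d + A + B in
  s_Z a = s_Z (a + fib d) -> s_Z (a + fib d) = s_Z (a + 2 * fib d) ->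
  s_Z (a + 2 * fib d) = s_Z (a + 3 * fib d) -> False.
Proof.
move=> zA ltB a.
(* The doubled digit is resolved by [2 * fib d = fib d.+1 + fib e]. *)
pose B' := fib e + B.
have ltB' : B' < fib d by rewrite /B' (fibSS e) addnC ltn_add2r.
have sB' : s_Z B' <= (s_Z B).+1 by apply: s_Z_fibD_le.
have ea1 : a + fib d = fib d.+1 + A + B'.
  by rewrite /a /B' (fibSS e.+1) (fibSS e); lia.
have sa : s_Z a = (s_Z A).+1 + s_Z B.
  rewrite /a (@s_Z_split e.+1) //; first by rewrite s_Z_aboveD.
  exact: ZeckAboveD.
have [zA3|[A' zA4 eA]] := zeck_above_case zA.
  have -> : a + 3 * fib d = fib d.+1 + A + B' + 2 * fib d by lia.
  have -> : a + 2 * fib d = fib d.+1 + A + B' + fib d by lia.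
  by rewrite ea1 => _; apply: no_three_from_fib_dS.
rewrite eA s_Z_aboveD // in sa.
have ea1' : a + fib d = fib d.+3 + A' + B'.
  by rewrite ea1 eA (fibSS d.+1); lia.
have [z3 _] := @zeck_above_carry d.+3 A' isT zA4.
have sa1 : s_Z (a + fib d) = s_Z (fib d.+3 + A') + s_Z B'.
  by rewrite ea1' (@s_Z_split d) //; apply: zeck_above_le z3; lia.
(* With [d.+4] present, the carry loses at least two summands, while [B'] gains at most one over
   [B]. *)
have [zA5|[A2 zA6 eA']] := zeck_above_case zA4; last first.
  have [_ le5] := @zeck_above_carry d.+4.+1 A2 isT zA6.
  have ec : fib d.+3 + A' = fib d.+4.+1 + A2.
    by rewrite eA' (fibSS d.+3); lia.
  by rewrite ec in sa1; rewrite eA' s_Z_aboveD // in sa; lia.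
have [ltB1|[C [ltC eB eD sB]]] := low_part_case ltB'.
  have ea2 : a + 2 * fib d = fib d.+3 + A' + B' + fib d by lia.
  rewrite ea2 s_Z_add_fib_low // -?ea1'; first by lia.
  by apply: zeck_above_le z3.
have ltC' : C < fib d by apply: (leq_trans ltC); apply: leq_fib; lia.
have zs : zeck_above d.+3 (fib d.+3 + A') by apply: ZeckAboveD.
(* In the third step [fib d], [fib d.+1] and [fib d.+3] collapse to [fib d.+4]. *)
have -> : a + 3 * fib d = fib d.+1 + (fib d.+3 + A') + C + fib d by lia.
have -> : a + 2 * fib d = fib d.+1 + (fib d.+3 + A') + C by lia.
have -> : fib d.+1 + (fib d.+3 + A') + C + fib d = fib d.+4 + A' + C.
  by rewrite (fibSS d.+2) (fibSS d); lia.
have [z4 le4] := @zeck_above_carry d.+4 A' isT zA5.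
rewrite (@s_Z_split d _ C) //; last exact: ZeckAboveD.
rewrite (@s_Z_split d _ C) //; last by apply: zeck_above_le z4; lia.
by rewrite s_Z_aboveD // s_Z_aboveD //; lia.
Qed.

End DigitPatterns.

(** * Two-summand progressions and the conclusion *)

Lemma s_Z_fib n : 0 < n -> s_Z (fib n) = 1.
Proof.
case: n => [|[|n]] // _; last first.
  by rewrite -[fib _]addn0 s_Z_fibD ?s_Z0 ?fib_gt0.
by rewrite (_ : fib 1 = fib 2 + 0) // s_Z_fibD ?s_Z0.
Qed.

(* The gap is 3 because of [fib 1 = fib 2]: [fib 3 + fib 1 = fib 4]. *)
Lemma s_Z_fib_pair m n : 0 < m -> m.+2 < n -> s_Z (fib n + fib m) = 2.
Proof.
case: n => [|[|n]] // m0 ltmn; rewrite s_Z_fibD ?s_Z_fib //.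
by apply: (leq_ltn_trans (leq_fib (leqnSn m))); apply: fib_ltn; lia.
Qed.

Theorem theorem5p1 :
  (forall d : nat, 2 <= d ->
     infinite_set [set a : nat | 0 < a /\
       s_Z a = s_Z (a + fib d) /\ s_Z (a + fib d) = s_Z (a + 2 * fib d)]) /\
  (forall d : nat, 2 <= d ->
     ~ exists a : nat, 0 < a /\
       s_Z a = s_Z (a + fib d) /\
       s_Z (a + fib d) = s_Z (a + 2 * fib d) /\
       s_Z (a + 2 * fib d) = s_Z (a + 3 * fib d)).
Proof.
split=> [[|[|e]] // _|[|[|e]] // _ [a [_ [e1 [e2 e3]]]]].
  apply/infiniteP/pcard_leP/injfunPex.
  (* The offset keeps the top index at least 3 above [e.+4], the largest low index. *)
  exists (fun N => fib (N + e.+4.+3) + fib e.+1) => [N _ /=|M N _ _ /= /addIn eqMN].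
    have -> : fib (N + e.+4.+3) + fib e.+1 + fib e.+2 = fib (N + e.+4.+3) + fib e.+3.
      by rewrite (fibSS e.+1); lia.
    have -> : fib (N + e.+4.+3) + fib e.+1 + 2 * fib e.+2 =
              fib (N + e.+4.+3) + fib e.+4.
      by rewrite (fibSS e.+2) (fibSS e.+1); lia.
    by rewrite !s_Z_fib_pair; [have := fib_gt0 e; lia|lia..].
  have [ltMN|ltNM|//] := ltngtP M N.
    by have := @fib_ltn (M + e.+4.+3) (N + e.+4.+3); lia.
  by have := @fib_ltn (N + e.+4.+3) (M + e.+4.+3); lia.
have [//|A [B [ea [[zA ltB]|[zA ltB]]]]] := @zeck_cut e.+2 a.
  by apply: (no_four_digit_d0 zA ltB); rewrite -ea.
(* With digit [d] absent, the second form is an instance of the first. *)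
have [zA'|[A' zA' eA]] := zeck_above_case zA.
  apply: (no_four_digit_d0 zA' (B := B)); rewrite -?ea //.
  by apply: (leq_trans ltB); apply: leq_fib.
by apply: (no_four_digit_d1 zA' ltB); rewrite -eA -ea.
Qed.
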